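(* Let $n\ge 1$ and let $G$ be a (finite, simple) graph on $n$ vertices. Then \[ \partial(G)+\partial(\bar{G})\le 2^{n+1}-2^{\lfloor n/2\rfloor}-2^{\lceil n/2\rceil-1}. \]
   Context: A dominating set in a graph $G$ is a set $S$ of vertices such that every vertex of $G$ is either in $S$ or adjacent to a vertex of $S$. $\partial(G)$ denotes the number of dominating sets of $G$, and $\bar{G}$ denotes the complement of $G$ (same vertex set, two distinct vertices adjacent in $\bar G$ iff they are non-adjacent in $G$). *)

(* Defs.v *)
From mathcomp Require Import all_boot.

Set Implicit Arguments.
Unset Strict Implicit.
Unset Printing Implicit Defensive.

(* A finite simple graph on the vertex type V is a symmetric and irreflexive
   adjacency relation e : rel V. *)

Definition compl_graph (V : finType) (e : rel V) : rel V :=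
  [rel x y | (x != y) && ~~ e x y].

Definition dominating (V : finType) (e : rel V) (S : {set V}) : bool :=
  [forall v, (v \in S) || [exists u in S, e v u]].

Definition num_dominating (V : finType) (e : rel V) : nat :=
  #|[set S : {set V} | dominating e S]|.

(* Main.v *)
(* For any vertex v, no set of non-neighbours of v (excluding v) dominates v.
   If v has a neighbours and b non-neighbours, so that a + b = n - 1, at least
   2 ^ b sets are therefore not dominating in the graph and at least 2 ^ a in
   its complement; by convexity 2 ^ a + 2 ^ b is least when a and b are as
   balanced as possible. *)

Require Import Defs.
From mathcomp Require Import all_boot.
From mathcomp Require Import zify.

Lemma num_dominating_le (V : finType) (e : rel V) (v : V) :
  num_dominating e + 2 ^ #|[set u | (u != v) && ~~ e v u]| <= 2 ^ #|V|.
Proof.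
set A := [set u | _].
(* Both powers of two become counts of sets; it remains to see that dominating sets lie outside
   [powerset A]. *)
rewrite -[#|V|]cardsT -!card_powerset powersetT cardsT -(cardsC (powerset A)).
rewrite addnC leq_add2l; apply/subset_leq_card/subsetP => S; rewrite !inE.
move=> /forallP/(_ v) dom_v; apply/negP => /subsetP subS.
case/orP: dom_v => [/subS | /existsP [u /andP [/subS]]]; rewrite inE.
  by rewrite eqxx.
by case/andP => _ /negP.
Qed.

Lemma leq_expn2_balanced (a b c d : nat) :
  a + b = c + d -> c <= d <= c.+1 -> 2 ^ d + 2 ^ c <= 2 ^ a + 2 ^ b.
Proof.
move=> ab_cd /andP [le_cd le_dc].
wlog le_ab : a b ab_cd / a <= b => [IH | ].
  case: (leqP a b) => [|/ltnW] le; first exact: IH.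
  by rewrite [leqRHS]addnC; apply: IH; rewrite // addnC.
have le_ac : a <= c by lia.
have -> : b = d + (c - a) by lia.
(* With [k = c - a], the claim amounts to [(2 ^ d - 2 ^ a) * (2 ^ k - 1) >= 0]. *)
rewrite -{1}(subnKC le_ac) !expnD.
have le_ad : 2 ^ a <= 2 ^ d by rewrite leq_exp2l //; lia.
have : 0 < 2 ^ (c - a) by rewrite expn_gt0.
nia.
Qed.

(* MathComp world *)
Theorem theorem1 (n : nat) (V : finType) (e : rel V) :
  1 <= n -> #|V| = n -> symmetric e -> irreflexive e ->
  num_dominating e + num_dominating (compl_graph e)
    <= 2 ^ n.+1 - 2 ^ n./2 - 2 ^ (uphalf n).-1.
Proof.
move=> n_gt0 cardV _ _.
have /card_gt0P [v _] : 0 < #|V| by rewrite cardV.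
have := num_dominating_le V e v; have := num_dominating_le V (compl_graph e) v.
set A := [set u | _ && ~~ compl_graph e v u].
set B := [set u | _ && ~~ e v u].
(* Negating twice makes [A] the neighbours of [v] other than [v], so [A] and [B] partition
   [[set~ v]]. *)
have cardAB : #|A| + #|B| = n.-1.
  have -> : n.-1 = #|[set~ v]| by rewrite cardsC1 cardV.
  rewrite -(cardsID A [set~ v]); congr (_ + _);
    by apply: eq_card => u; rewrite !inE /compl_graph /= [v == u]eq_sym; case: eqP; case: (e v u).
have : 2 ^ n./2 + 2 ^ (uphalf n).-1 <= 2 ^ #|A| + 2 ^ #|B|.
  (* The exponents are n/2 and n/2 - 1 for even n, and both (n - 1)/2 for odd n. *)
  by apply: leq_expn2_balanced; lia.
rewrite cardV expnS; lia.
Qed.
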